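(* Let $n\ge 1$ and $\alpha\in(0,1)$, and suppose assumptions A.1 and A.3 (stated in the context) hold. Consider the stepup procedure with critical values $\alpha_i=i\alpha/n$, $i=1,\dots,n$ (Procedure 6), applied to the $2n$ $p$-values of the hypotheses in $\mathcal{F}_1=\{H_{ij}: i=1,\dots,n,\ j=1,2\}$. Then this procedure strongly controls $\mathrm{FDR}_{\mathcal{F}_1}$ at level $\alpha$; that is, $\mathrm{FDR}_{\mathcal{F}_1}(\theta)\le\alpha$ for every parameter vector $\theta$.
   Context: Setting. $T_1,\dots,T_n$ are real-valued test statistics whose joint law $\mathrm{Pr}_\theta$ (expectation $E_\theta$) depends on an unknown vector $\theta=(\theta_1,\dots,\theta_n)$ of real parameters. $T_i$ has cumulative distribution function $F_{i,\theta_i}$ depending only on $\theta_i$; $F_{i,0}$ is continuous and symmetric about zero, $F_{i,0}(-t)=1-F_{i,0}(t)$ for all $t$; and $F_{i,\theta_i}(t)$ is non-increasing in $\theta_i$ for each fixed $t$. Hypotheses and $p$-values. For $i=1,\dots,n$: $H_{i1}:\theta_i\le 0$ (versus $\theta_i>0$), with $p$-value $1-F_{i,0}(T_i)$, and $H_{i2}:\theta_i>0$ (versus $\theta_i<0$), with $p$-value $F_{i,0}(T_i)$. Under any $\theta$ exactly one of $H_{i1},H_{i2}$ is true. Let $H_i$ denote the true one and $H_{n+i}$ the false one, with $p$-values $P_i$ and $P_{n+i}=1-P_i$; thus $P_i=1-F_{i,0}(T_i)$ if $\theta_i\le 0$ and $P_i=F_{i,0}(T_i)$ if $\theta_i>0$.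 Put $I_0=\{1,\dots,n\}$ (indices of the true nulls). The procedure uses only the $2n$ $p$-values and not the knowledge of which hypotheses are true. Stepup procedure. Let $P_{(1)}\le\dots\le P_{(2n)}$ be the ordered $p$-values and $H_{(1)},\dots,H_{(2n)}$ the associated hypotheses. The stepup procedure with critical values $\alpha_1\le\dots\le\alpha_n$ rejects $H_{(1)},\dots,H_{(i^* )}$ and accepts the rest, where $i^*=\max\{1\le i\le n: P_{(i)}\le\alpha_i\}$ if the maximum exists; otherwise it accepts all hypotheses. (Only the first $n$ critical values are defined, since at least $n$ of the $2n$ $p$-values are $\ge 0.5$.) Error rate. $R_1$ is the number of rejected hypotheses in $\mathcal{F}_1$, $V_1$ the number of true hypotheses among them, and $\mathrm{FDR}_{\mathcal{F}_1}(\theta)=E_\theta\left(V_1/\max(R_1,1)\right)$. Assumptions. A.1: for each $i\in I_0$ and each $\theta_i$, $\mathrm{Pr}_{\theta_i}\{P_i\le p\}\le p$ for all $0\le p\le 1$, with equality when $\theta_i=0$ (i.e. $P_i\sim U(0,1)$ when $\theta_i=0$). A.3: $T_1,\dots,T_n$ are mutually independent. *)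

(* Defs.v *)
From mathcomp Require Import all_boot all_order all_algebra.
From mathcomp Require Import all_classical all_reals all_analysis.

Set Implicit Arguments.
Unset Strict Implicit.
Unset Printing Implicit Defensive.

Import Order.TTheory GRing.Theory Num.Theory.
Import numFieldNormedType.Exports.

Local Open Scope classical_set_scope.
Local Open Scope ring_scope.

(* The index set of the family F_1 of 2n one-sided hypotheses:
   (i, false) is H_i1 : theta_i <= 0 and (i, true) is H_i2 : theta_i > 0. *)
Notation hyp n := ('I_n * bool)%type.

Definition is_true_hyp (R : realType) (n : nat) (theta : 'I_n -> R)
    (h : hyp n) : bool :=
  if h.2 then 0 < theta h.1 else theta h.1 <= 0.

(* For every i exactly one of H_i1, H_i2 is true; this is its index. *)
Definition true_hyp (R : realType) (n : nat) (theta : 'I_n -> R)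
    (i : 'I_n) : hyp n := (i, 0 < theta i).

(* p-value of each hypothesis at the observed statistics t, where F0 i is the
   distribution function of the i-th statistic under theta_i = 0. *)
Definition pvalue (R : realType) (n : nat) (F0 : 'I_n -> R -> R)
    (t : 'I_n -> R) (h : hyp n) : R :=
  if h.2 then F0 h.1 (t h.1) else 1 - F0 h.1 (t h.1).

(* s enumerates H_(1), ..., H_(2n).  Ties among p-values may be broken
   arbitrarily, so s is not determined by p. *)
Definition is_ordering (R : realType) (n : nat) (p : hyp n -> R)
    (s : (2 * n).-tuple (hyp n)) : Prop :=
  perm_eq s (enum {: hyp n}) /\ sorted <=%R [seq p h | h <- s].

(* P_(i), numbered from i = 1. *)
Definition ordered_pvalue (R : realType) (n : nat) (p : hyp n -> R)
    (s : (2 * n).-tuple (hyp n)) (i : nat) : R :=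
  nth 0 [seq p h | h <- s] i.-1.

(* i^* ; the empty maximum is 0, in which case nothing is rejected.  The index
   stops at n because at least n of the 2n p-values are >= 1/2. *)
Definition stepup_index (R : realType) (n : nat) (crit : nat -> R)
    (p : hyp n -> R) (s : (2 * n).-tuple (hyp n)) : nat :=
  \max_(1 <= i < n.+1 | ordered_pvalue p s i <= crit i) i.

Definition stepup_rejected (R : realType) (n : nat) (crit : nat -> R)
    (p : hyp n -> R) (s : (2 * n).-tuple (hyp n)) : {set hyp n} :=
  [set h in take (stepup_index crit p s) s]%SET.

(* False discovery proportion, with 0 / 0 read as 0. *)
Definition FDP (R : realType) (n : nat) (theta : 'I_n -> R)
    (rej : {set hyp n}) : R :=
  #|[set h in rej | is_true_hyp theta h]%SET|%:R / (maxn #|rej| 1)%:R.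

Definition mutually_independent (d : measure_display)
    (Omega : measurableType d) (R : realType) (P : probability Omega R)
    (I : finType) (X : I -> {mfun Omega >-> R}) : Prop :=
  forall (J : {set I}) (B : I -> set R), (forall i, measurable (B i)) ->
    P (\bigcap_(i in [set` J]) X i @^-1` B i) =
    (\prod_(i in J) P (X i @^-1` B i))%E.

Definition true_null_superuniform (d : measure_display)
    (Omega : measurableType d) (R : realType) (n : nat)
    (Pr : ('I_n -> R) -> probability Omega R)
    (F0 : 'I_n -> R -> R) (T : 'I_n -> {mfun Omega >-> R}) : Prop :=
  forall (theta : 'I_n -> R) (i : 'I_n) (x : R), 0 <= x <= 1 ->
    let P_i w := pvalue F0 (fun j => T j w) (true_hyp theta i) in
    (Pr theta [set w | (P_i w <= x)%R] <= x%:E)%E /\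
    (theta i = 0 -> Pr theta [set w | (P_i w <= x)%R] = x%:E).

(* arrange p is the arrangement used when the p-values are p: like the whole
   procedure, it depends on the data through the p-values only. *)
Definition FDR (d : measure_display) (Omega : measurableType d)
    (R : realType) (n : nat) (Pr : ('I_n -> R) -> probability Omega R)
    (F0 : 'I_n -> R -> R) (T : 'I_n -> {mfun Omega >-> R})
    (crit : nat -> R) (arrange : (hyp n -> R) -> (2 * n).-tuple (hyp n))
    (theta : 'I_n -> R) : \bar R :=
  'E_(Pr theta)[fun w =>
    let p := pvalue F0 (fun i => T i w) in
    FDP theta (stepup_rejected crit p (arrange p))].

(* Main.v *)
(* Write [P_i] for the true p-value of the pair [{P_i, 1 - P_i}] and [c_k] for
   the critical values.  If [H_i] is rejected when [R] hypotheses are, then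
   [P_i <= c_R] and [R] equals the index [R_i] computed with the [i]-th pair
   counted as exactly one small p-value: for [k >= R], either [c_k < 1/2], so
   that [1 - P_i > c_k], or [c_k >= 1/2], so that every pair contributes a
   p-value [<= c_k] and all counts reach [n].  Hence
   [FDP <= sum_i 1{P_i <= c_(R_i)} / R_i].  Since [R_i] depends only on the
   statistics [T_j], [j != i], conditioning on it bounds each expectation by
   [(R_i alpha / n) / R_i = alpha / n]. *)
Require Import Defs.
From mathcomp Require Import all_boot all_order all_algebra.
From mathcomp Require Import all_classical all_reals all_analysis.
From mathcomp Require Import measurable_realfun lra.

Set Implicit Arguments.
Unset Strict Implicit.
Unset Printing Implicit Defensive.

Import Order.TTheory GRing.Theory Num.Theory.
Import numFieldNormedType.Exports.

Local Open Scope classical_set_scope.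
Local Open Scope ring_scope.

(** * Largest index in a range satisfying a predicate *)

Lemma bigmax_nat_attained (m n : nat) (a : pred nat) :
  (0 < \max_(m <= k < n | a k) k)%N ->
  (m <= \max_(m <= k < n | a k) k < n)%N && a (\max_(m <= k < n | a k) k).
Proof.
rewrite big_nat_cond; elim/big_ind: _ => // x y IHx IHy.
by rewrite /maxn; case: ifP.
Qed.

Lemma leq_bigmax_nat (m n : nat) (a : pred nat) (k : nat) :
  (m <= k < n)%N -> a k -> (k <= \max_(m <= i < n | a i) i)%N.
Proof. by move=> kmn ak; apply: leq_bigmax_seq => //; rewrite mem_index_iota. Qed.

(** The [a]-maximum satisfies [b] as well, so the [b]-maximum is at least as large. It therefore
    lies where the predicates agree and satisfies [a], which gives the converse inequality. *)
Lemma eq_bigmax_above (m n : nat) (a b : pred nat) :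
  (0 < \max_(m <= k < n | a k) k)%N ->
  (forall k, (\max_(m <= k < n | a k) k <= k < n)%N -> a k = b k) ->
  \max_(m <= k < n | a k) k = \max_(m <= k < n | b k) k.
Proof.
set A := (X in (0 < X)%N) => A0 ab.
have /andP[/andP[mA An] aA] := bigmax_nat_attained A0.
have AB : (A <= \max_(m <= k < n | b k) k)%N.
  by apply: leq_bigmax_nat; rewrite ?mA// -ab ?leqnn.
apply/eqP; rewrite eqn_leq AB/=.
have /andP[/andP[mB Bn] bB] := bigmax_nat_attained (leq_trans A0 AB).
by apply: leq_bigmax_nat; rewrite ?mB// ab ?AB.
Qed.

(** * Ordered p-values and the rejected set *)

(** Turns the stepup condition into a count of small p-values, which does not depend on how ties are
    broken. *)
Lemma ordered_pvalue_le (R : realType) (n : nat) (p : hyp n -> R)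
    (s : (2 * n).-tuple (hyp n)) (c : R) (k : nat) :
  is_ordering p s -> (0 < k <= 2 * n)%N ->
  (ordered_pvalue p s k <= c) = (k <= #|[set h | (p h <= c)%R]%SET|)%N.
Proof.
move=> [ps sorteds] /andP[k0 kn].
have <- : count (<= c) [seq p h | h <- s] = #|[set h | p h <= c]%SET|.
  rewrite count_map (permP ps) cardE size_filter enumT.
  by apply: eq_count => h; rewrite /= inE.
have ks : (k.-1 < size [seq p h | h <- s])%N.
  by rewrite size_map size_tuple prednK.
rewrite /ordered_pvalue -[in RHS](prednK k0); apply/idP/idP => [|kc].
  by apply: contraTT; rewrite -leqNgt -ltNge => ck; apply: nth_count_gt; rewrite ?ck.
exact: nth_count_le.
Qed.

Lemma card_rejected (R : realType) (n : nat) (crit : nat -> R)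
    (p : hyp n -> R) (s : (2 * n).-tuple (hyp n)) :
  is_ordering p s -> #|stepup_rejected crit p s| = stepup_index crit p s.
Proof.
move=> [ps _].
have us : uniq (take (stepup_index crit p s) s).
  by rewrite take_uniq// (perm_uniq ps) enum_uniq.
rewrite /stepup_rejected cardsE (card_uniqP us) size_takel// size_tuple.
rewrite /stepup_index big_nat_cond; elim/big_ind: _ => // [x y xn yn|k].
  by rewrite geq_max xn.
by move=> /andP[/andP[_ kn] _]; rewrite (leq_trans (n := n))// mul2n -addnn leq_addr.
Qed.

Lemma rejected_pvalue_le (R : realType) (n : nat) (crit : nat -> R)
    (p : hyp n -> R) (s : (2 * n).-tuple (hyp n)) (h : hyp n) :
  is_ordering p s -> h \in stepup_rejected crit p s ->
  (0 < stepup_index crit p s <= n)%N /\ p h <= crit (stepup_index crit p s).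
Proof.
move=> [ps sorteds]; rewrite inE => hs.
have m0 : (0 < stepup_index crit p s)%N.
  by case: (stepup_index crit p s) hs; rewrite ?take0.
have /andP[/andP[_ mn] pm] := bigmax_nat_attained m0.
rewrite ltnS -/(stepup_index crit p s) in mn.
rewrite -/(stepup_index crit p s) in pm.
split; first by rewrite m0.
apply: le_trans pm.
have := hs; rewrite -index_mem => hm.
have hsz : (index h (take (stepup_index crit p s) s) < stepup_index crit p s)%N.
  by apply: leq_trans hm _; rewrite size_take_min geq_minl.
have m2n : ((stepup_index crit p s).-1 < size s)%N.
  by rewrite prednK// size_tuple mul2n -addnn (leq_trans mn)// leq_addr.
have -> : p h = nth 0 [seq p h | h <- s] (index h (take (stepup_index crit p s) s)).
  rewrite (nth_map h); last first.
    by rewrite (leq_ltn_trans _ m2n)// -ltnS prednK.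
  by rewrite -[in RHS](nth_take _ hsz) nth_index.
apply: le_sorted_leq_nth => //; rewrite ?inE ?size_map//.
  by rewrite (leq_ltn_trans _ m2n)// -ltnS prednK.
by rewrite -ltnS prednK.
Qed.

(** * Leave-one-out indices and the pointwise bound on the FDP *)

(* The [R_i] of the header, with [small k h] standing for [p h <= crit k]. *)
Definition loo_index (n : nat) (small : nat -> pred (hyp n)) (i : 'I_n) : nat :=
  \max_(1 <= k < n.+1 | (k <= #|[set h | (h.1 != i) && small k h]%SET|.+1)%N) k.

Lemma loo_indexE (R : realType) (n : nat) (crit : nat -> R)
    (p : hyp n -> R) (s : (2 * n).-tuple (hyp n)) (h : hyp n) :
  is_ordering p s ->
  (forall i, p (i, true) = 1 - p (i, false)) ->
  (forall k l, (k <= l)%N -> crit k <= crit l) ->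
  h \in stepup_rejected crit p s ->
  stepup_index crit p s = loo_index (fun k h => p h <= crit k) h.1.
Proof.
move=> ps pC crit_nd hrej.
have [/andP[m0 mn] hm] := rejected_pvalue_le ps hrej.
apply: eq_bigmax_above => // k /andP[mk]; rewrite ltnS => kn.
have k0 := leq_trans m0 mk.
have hk : p h <= crit k by apply: le_trans hm _; exact: crit_nd.
rewrite ordered_pvalue_le//; last first.
  by rewrite k0 (leq_trans kn)// mul2n -addnn leq_addr.
set A := [set h | p h <= crit k]%SET.
set B := [set h' | (h'.1 != h.1) && (p h' <= crit k)]%SET.
have hB : h \notin B by rewrite inE eqxx.
have BA : h |: B \subset A.
  by apply/fintype.subsetP => g; rewrite !inE => /predU1P[->//|/andP[]].
have cB : #|h |: B| = #|B|.+1 by rewrite cardsU1 hB.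
have [half|half] := ltP (crit k) (2^-1).
  (* The two p-values of the pair of [h] sum to 1, so they cannot both lie below 1/2: [h] is the
     only member of its pair in [A]. *)
  suff -> : A = h |: B by rewrite cB.
  apply/eqP; rewrite finset.eqEsubset BA andbT; apply/fintype.subsetP => -[j b].
  rewrite !inE/= => jb; rewrite jb andbT.
  case: (eqVneq j h.1) => [jh|]; rewrite ?orbT//= orbF.
  move: jb hk; rewrite jh; case: (h) => i b'/=; case: b; case: b' => //.
    by rewrite pC; lra.
  by rewrite pC; lra.
have nB : (n <= #|B|.+1)%N.
  have nE : #|[set~ h.1]%SET|.+1 = n.
    by rewrite cardsC1 card_ord prednK// (leq_trans k0).
  (* From each of the other [n - 1] pairs, select the [false] member if its p-value is at most
     [crit k]; otherwise the [true] member qualifies, its p-value being below 1/2. *)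
  rewrite -[leqLHS]nE ltnS -(card_imset (f := fun j => (j, ~~ (p (j, false) <= crit k)))).
    apply/subset_leq_card/fintype.subsetP => _ /imsetP[j + ->].
    rewrite !inE/= => -> /=; have [//|jc] := leP (p (j, false)) (crit k).
    by rewrite pC; lra.
  by move=> ? ? [].
(* Both counts reach [n >= k], so both conditions hold. *)
by rewrite (leq_trans kn nB) (leq_trans (leq_trans kn nB))// -cB subset_leq_card.
Qed.

Lemma FDP_le_sum (R : realType) (n : nat) (theta : 'I_n -> R) (crit : nat -> R)
    (p : hyp n -> R) (s : (2 * n).-tuple (hyp n)) :
  is_ordering p s ->
  (forall i, p (i, true) = 1 - p (i, false)) ->
  (forall k l, (k <= l)%N -> crit k <= crit l) ->
  FDP theta (stepup_rejected crit p s) <=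
  \sum_(i < n)
    (p (true_hyp theta i) <=
      crit (loo_index (fun k h => p h <= crit k) i))%R%:R *
    (loo_index (fun k h => p h <= crit k) i)%:R^-1.
Proof.
move=> ps pC crit_nd; rewrite /FDP.
pose m i := loo_index (fun k h => p h <= crit k) i.
set rej := stepup_rejected crit p s.
(* Each pair has exactly one true member, so true rejections can be counted by pair index. *)
have -> : [set h in rej | is_true_hyp theta h]%SET =
    [set true_hyp theta i | i in [set i | true_hyp theta i \in rej]%SET]%SET.
  apply/setP => -[j b]; rewrite finset.in_set; apply/andP/imsetP => [[jr jt]|[i + [-> ->]]].
    have jE : (j, b) = true_hyp theta j.
      by rewrite /true_hyp; move: jt; rewrite /is_true_hyp/=; case: b {jr} => [->|];
        rewrite // leNgt => /negbTE ->.
    by exists j => //; rewrite finset.in_set -jE.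
  rewrite finset.in_set => ir; split; first exact: ir.
  by rewrite /is_true_hyp/=; case: ifP => // /negbT; rewrite -leNgt.
rewrite card_imset; last by move=> ? ? [].
rewrite -sum1_card natr_sum mulr_suml big_mkcond/=; apply: ler_sum => i _.
rewrite inE; case: ifPn => [ir|_]; last by rewrite mulr_ge0// invr_ge0.
have [/andP[r0 _] le_r] := rejected_pvalue_le ps ir.
have rm := loo_indexE ps pC crit_nd ir.
rewrite card_rejected// (maxn_idPl r0) rm/= -/(m i).
by rewrite rm/= -/(m i) in le_r; rewrite le_r.
Qed.

(** * Monotonicity of the integral *)

(** The integral of a non-negative function is a supremum over the simple functions below it;
    enlarging the function only adds competitors. *)
Lemma ge0_le_integral_nonmeasurable (d : measure_display) (T : measurableType d)
    (R : realType) (mu : {measure set T -> \bar R}) (f g : T -> \bar R) :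
  (forall x, 0 <= f x)%E -> (forall x, f x <= g x)%E ->
  (\int[mu]_x f x <= \int[mu]_x g x)%E.
Proof.
move=> f0 fg; have g0 x : (0 <= g x)%E by exact: le_trans (fg x).
rewrite !ge0_integralTE//; apply: ereal_sup_le => _ [h hf <-].
by exists h => // x; exact: le_trans (fg x).
Qed.

(** * Independence of a statistic from the profile of the others *)

(* Coordinate [i] is pinned to [k0], so the profile ignores [X i]. *)
Definition loo_profile (I K : finType) (T V : Type) (X : I -> T -> V)
    (S : I -> V -> K) (i : I) (k0 : K) (w : T) : {ffun I -> K} :=
  [ffun j => if j == i then k0 else S j (X j w)].

(** Puts a profile event in the product form used by [mutually_independent]. [C i] is left free so
    that the same family can also carry an event on [X i]. *)
Lemma loo_profile_preimage (I K : finType) (T V : Type) (X : I -> T -> V)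
    (S : I -> V -> K) (i : I) (k0 : K) (d : {ffun I -> K}) (C : I -> set V) :
  d i = k0 -> (forall j, j != i -> C j = S j @^-1` [set d j]) ->
  loo_profile X S i k0 @^-1` [set d] =
  \bigcap_(j in [set` [set~ i]%SET]) X j @^-1` C j.
Proof.
move=> di CE; apply/seteqP; split => [w /= dw j|w Cw].
  by rewrite /= !inE => ji; rewrite CE//= -dw ffunE (negbTE ji).
apply/ffunP => j; rewrite ffunE; case: eqVneq => [->//|ji].
by have := Cw j; rewrite CE//=; apply; rewrite /= !inE.
Qed.

Lemma measurable_loo_profile (disp : measure_display)
    (Omega : measurableType disp) (R : realType) (I K : finType)
    (X : I -> {mfun Omega >-> R}) (S : I -> R -> K) (i : I) (k0 : K) :
  (forall j k, measurable (S j @^-1` [set k])) ->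
  forall d, measurable (loo_profile X S i k0 @^-1` [set d]).
Proof.
move=> mS d; case: (eqVneq (d i) k0) => [di|dNi].
  rewrite (@loo_profile_preimage _ _ _ _ _ _ _ _ _
    (fun j => S j @^-1` [set d j]))//.
  apply: fin_bigcap_measurable => // j _.
  by rewrite -[X in measurable X]setTI; apply: measurable_funP.
rewrite (_ : _ @^-1` _ = set0)//; apply/seteqP; split => // w /= dw.
by move: dNi; rewrite -dw ffunE eqxx eqxx.
Qed.

(** Independence is applied to all coordinates and to all but [i]; the two products differ by the
    factor of [X i]. *)
Lemma loo_profile_independent (disp : measure_display)
    (Omega : measurableType disp) (R : realType) (P : probability Omega R)
    (I K : finType) (X : I -> {mfun Omega >-> R}) (S : I -> R -> K)
    (i : I) (k0 : K) (d : {ffun I -> K}) (B : set R) :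
  mutually_independent P X ->
  (forall j k, measurable (S j @^-1` [set k])) -> measurable B ->
  P (loo_profile X S i k0 @^-1` [set d] `&` X i @^-1` B) =
  (P (loo_profile X S i k0 @^-1` [set d]) * P (X i @^-1` B))%E.
Proof.
move=> indep mS mB; case: (eqVneq (d i) k0) => [di|dNi]; last first.
  have -> : loo_profile X S i k0 @^-1` [set d] = set0.
    apply/seteqP; split => // w /= dw.
    by move: dNi; rewrite -dw ffunE eqxx eqxx.
  by rewrite set0I measure0 mul0e.
pose C j := if j == i then B else S j @^-1` [set d j].
have mC j : measurable (C j) by rewrite /C; case: ifP.
have CE j : j != i -> C j = S j @^-1` [set d j] by rewrite /C => /negbTE ->.
have Ci : C i = B by rewrite /C eqxx.
rewrite (loo_profile_preimage _ di CE) -Ci.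
have -> : \bigcap_(j in [set` [set~ i]%SET]) X j @^-1` C j `&` X i @^-1` C i =
    \bigcap_(j in [set` [set: I]%SET]) X j @^-1` C j.
  apply/seteqP; split => [w [Cw Cwi] j _|w Cw].
    by case: (eqVneq j i) => [->//|ji]; apply: Cw; rewrite /= !inE.
  by split=> [j _|]; apply: Cw; rewrite /= inE.
rewrite !indep// (bigD1 i)/= ?inE// muleC; congr (_ * _)%E.
by apply: eq_bigl => j; rewrite !inE.
Qed.

(** Conditioning on [D], done as a finite sum: on [D = d] both the set and the weight are fixed, so
    independence makes the integral an average of quantities at most [a]. *)
Lemma integral_loo_profile_le (disp : measure_display)
    (Omega : measurableType disp) (R : realType) (P : probability Omega R)
    (I K : finType) (X : I -> {mfun Omega >-> R}) (S : I -> R -> K)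
    (i : I) (k0 : K) (B : {ffun I -> K} -> set R) (c : {ffun I -> K} -> R)
    (a : R) :
  mutually_independent P X ->
  (forall j k, measurable (S j @^-1` [set k])) ->
  (forall d, measurable (B d)) -> (forall d, 0 <= c d) ->
  (forall d, P (X i @^-1` B d) * (c d)%:E <= a%:E)%E ->
  let D := loo_profile X S i k0 in
  let f (w : Omega) : \bar R := (\1_(B (D w)) (X i w) * c (D w))%:E in
  measurable_fun setT f /\ (\int[P]_w f w <= a%:E)%E.
Proof.
move=> indep mS mB c0 Ba D f.
have mD d : measurable (D @^-1` [set d]) by exact: measurable_loo_profile.
have mXB d : measurable (X i @^-1` B d).
  by rewrite -[X in measurable X]setTI; apply: measurable_funP.
pose E d := D @^-1` [set d] `&` X i @^-1` B d.
have mE d : measurable (E d) by apply: measurableI.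
(* Only the summand with [d = D w] can be nonzero. *)
have fE w : f w = (\sum_d (c d)%:E * (\1_(E d) w)%:E)%E.
  rewrite (bigD1 (D w))//= big1 => [|d dDw]; last first.
    rewrite indicE memNset ?mule0// => -[/= Dw _].
    by rewrite Dw eqxx in dDw.
  rewrite adde0 -EFinM mulrC; congr (_ * _)%:E.
  rewrite !indicE; congr (nat_of_bool _)%:R.
  by apply/idP/idP; rewrite !inE /E => //= -[].
have mterm d : measurable_fun setT (fun w => (c d)%:E * (\1_(E d) w)%:E)%E.
  by apply: measurable_funeM; apply/measurable_EFinP; exact: measurable_indic.
have term0 d w : (0 <= (c d)%:E * (\1_(E d) w)%:E)%E.
  by rewrite mule_ge0// lee_fin.
rewrite (_ : f = fun w => \sum_d (c d)%:E * (\1_(E d) w)%:E)%E; last exact/funext.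
split; first exact: emeasurable_sum.
rewrite ge0_integral_sum//.
have intE d : (\int[P]_w ((c d)%:E * (\1_(E d) w)%:E) =
    P (D @^-1` [set d]) * ((c d)%:E * P (X i @^-1` B d)))%E.
  rewrite ge0_integralZl//.
  - rewrite integral_indic// setIT muleCA; congr (_ * _)%E.
    exact: loo_profile_independent.
  - by apply/measurable_EFinP; exact: measurable_indic.
  - by rewrite lee_fin.
rewrite (eq_bigr _ (fun d _ => intE d)).
apply: (@le_trans _ _ (\sum_d P (D @^-1` [set d]) * a%:E)%E).
  apply: lee_sum => d _; rewrite lee_wpmul2l ?measure_ge0// muleC.
  exact: Ba.
rewrite -ge0_sume_distrl//.
(* The fibres of [D] partition [Omega]. *)
have -> : (\sum_d P (D @^-1` [set d]) = 1)%E.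
  rewrite fsbig_seq ?index_enum_uniq// -measure_fin_bigcup//.
    rewrite -(@probability_setT _ _ _ P); congr (P _).
    by apply/seteqP; split => // w _; exists (D w); rewrite //= mem_index_enum.
  by move=> x y _ _ [w [/= <- <-]].
by rewrite mul1e.
Qed.

(** * Bounding the false discovery rate pair by pair *)

Lemma measurable_pvalue_le (R : realType) (n : nat) (F0 : 'I_n -> R -> R)
    (h : hyp n) (c : R) :
  (forall i, continuous (F0 i)) ->
  measurable [set x | pvalue F0 (fun=> x) h <= c].
Proof.
move=> F0_cont.
have mp : measurable_fun [set: R] (fun x => pvalue F0 (fun=> x) h).
  have mF : measurable_fun [set: R] (F0 h.1) by exact: continuous_measurable_fun.
  by rewrite /pvalue; case: h.2 => //; exact: measurable_funB.
rewrite (_ : [set x | _] = (fun x => pvalue F0 (fun=> x) h) @^-1` `]-oo, c]).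
  by rewrite -[X in measurable X]setTI; apply: mp => //; exact: measurable_itv.
by apply/seteqP; split => x /=; rewrite in_itv.
Qed.

Theorem theorem5 (R : realType) (n : nat) (n_ge1 : (1 <= n)%N)
    (alpha : R) (alpha01 : 0 < alpha < 1)
    (d : measure_display) (Omega : measurableType d)
    (Pr : ('I_n -> R) -> probability Omega R)
    (T : 'I_n -> {mfun Omega >-> R})
    (F : 'I_n -> R -> R -> R)
    (F_cdf : forall (theta : 'I_n -> R) (i : 'I_n) (t : R),
      cdf (T i : {RV (Pr theta) >-> R}) t = (F i (theta i) t)%:E)
    (F0_continuous : forall i : 'I_n, continuous (F i 0))
    (F0_symmetric : forall (i : 'I_n) (t : R), F i 0 (- t) = 1 - F i 0 t)
    (F_nonincreasing : forall (i : 'I_n) (t x y : R),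
      x <= y -> F i y t <= F i x t)
    (A1 : true_null_superuniform Pr (fun i => F i 0) T)
    (A3 : forall theta : 'I_n -> R, mutually_independent (Pr theta) T)
    (arrange : (hyp n -> R) -> (2 * n).-tuple (hyp n))
    (arrangeP : forall p : hyp n -> R, is_ordering p (arrange p))
    (arrange_measurable : forall s : (2 * n).-tuple (hyp n),
      measurable [set w : Omega |
        arrange (pvalue (fun i => F i 0) (fun i => T i w)) = s]) :
  forall theta : 'I_n -> R,
    (FDR Pr (fun i => F i 0)%R T (fun i => i%:R * alpha / n%:R)%R arrange theta
       <= alpha%:E)%E.

Proof.
move=> theta; rewrite /FDR unlock.
pose F0 i := F i 0; pose crit k : R := k%:R * alpha / n%:R.
have [alpha0 alpha1] := andP alpha01.
have n0 : 0 < n%:R :> R by rewrite ltr0n.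
have crit_nd k l : (k <= l)%N -> crit k <= crit l.
  by move=> kl; rewrite ler_pM2r ?invr_gt0// ler_pM2r// ler_nat.
(* A value of [K] records how both p-values of a pair compare with every critical value. This finite
   table is all that the leave-one-out index needs from a pair. *)
pose K := {ffun bool * 'I_n.+1 -> bool}.
pose S j x : K := [ffun bk : bool * 'I_n.+1 => pvalue F0 (fun=> x) (j, bk.1) <= crit bk.2].
pose k0 : K := [ffun=> false].
pose m i (d : {ffun 'I_n -> K}) := loo_index (fun k h => d h.1 (h.2, inord k)) i.
pose D i := loo_profile T S i k0.
have mS j g : measurable (S j @^-1` [set g]).
  rewrite (_ : _ @^-1` _ = \bigcap_(bk in [set: bool * 'I_n.+1])
    [set x | (pvalue F0 (fun=> x) (j, bk.1) <= crit bk.2) = g bk]).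
    apply: fin_bigcap_measurable => // -[b k] _ /=.
    have mQ := measurable_pvalue_le (j, b) (crit k) F0_continuous.
    case: (g _); first exact: mQ.
    rewrite (_ : [set x | _] = ~` [set x | pvalue F0 (fun=> x) (j, b) <= crit k]).
      exact: measurableC.
    by apply/seteqP; split => x /=; [move=> ->|move=> /negP/negbTE].
  apply/seteqP; split => [x /= <- bk _|x /= xg]; first by rewrite /= ffunE.
  by apply/ffunP => bk; rewrite ffunE; exact: xg.
(* The pinned coordinate is harmless because [loo_index] skips pair [i]; restricting to [k <= n]
   makes [inord k] faithful. *)
have mE i w : loo_index (fun k h => pvalue F0 (T ^~ w) h <= crit k) i = m i (D i w).
  rewrite /m /loo_index big_nat_cond [RHS]big_nat_cond; apply: eq_bigl => k.
  case: (boolP (1 <= k < n.+1)%N) => //= /andP[_ kn].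
  congr (_ <= _.+1)%N; apply: eq_card => h; rewrite !inE.
  by case: eqVneq => //= /negbTE hi; rewrite ffunE hi ffunE/= inordK.
have m_le i g : (m i g <= n)%N.
  rewrite /m /loo_index big_nat_cond; elim/big_ind: _ => // [x y xn yn|k].
    by rewrite geq_max xn.
  by move=> /andP[/andP[_ kn] _].
pose B i g := [set x | pvalue F0 (fun=> x) (true_hyp theta i) <= crit (m i g)].
have PB i g : (Pr theta (T i @^-1` B i g) * ((m i g)%:R^-1)%:E <= (alpha / n%:R)%:E)%E.
  (* A.1 covers levels in [0, 1] only; [m i g <= n] gives [crit (m i g) <= alpha]. *)
  have crit01 : 0 <= crit (m i g) <= 1.
    rewrite /crit !mulr_ge0//= ?invr_ge0 ?(ltW alpha0)// ler_pdivrMr// mul1r.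
    by rewrite -[leRHS]mulr1 ler_pM ?(ltW alpha0)// ?ler_nat ?m_le// ltW.
  have [Pcrit _] := A1 theta i _ crit01.
  apply: (@le_trans _ _ ((crit (m i g))%:E * ((m i g)%:R^-1)%:E)%E).
    by apply: lee_wpmul2r; [rewrite lee_fin|exact: Pcrit].
  rewrite -EFinM lee_fin /crit.
  (* At index 0 the left side is 0, since [crit 0 = 0]; otherwise the index cancels and leaves
     [alpha / n]. *)
  have [->|m0] := eqVneq (m i g) 0%N.
    by rewrite !mul0r divr_ge0// ltW.
  by rewrite mulrAC [X in X / _ / _]mulrC mulfK// pnatr_eq0.
pose f i w : \bar R := (\1_(B i (D i w)) (T i w) * (m i (D i w))%:R^-1)%:E.
have fP i : measurable_fun setT (f i) /\ (\int[Pr theta]_w f i w <= (alpha / n%:R)%:E)%E.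
  apply: (integral_loo_profile_le (B := B i) (c := fun d => (m i d)%:R^-1) k0
    (A3 theta) mS) => // g.
  exact: measurable_pvalue_le.
(* The FDP is dominated pointwise by the sum of the [f i], each of which has integral at most
   [alpha / n]. *)
apply: (@le_trans _ _ (\int[Pr theta]_w \sum_(i < n) f i w)%E).
  apply: ge0_le_integral_nonmeasurable => w.
    by rewrite lee_fin divr_ge0.
  rewrite sumEFin lee_fin.
  apply: le_trans (FDP_le_sum theta (arrangeP _) _ crit_nd) _.
    by move=> i; rewrite /pvalue/= subKr.
  apply: ler_sum => i _.
  rewrite mE indicE; apply: ler_wpM2r => //.
  rewrite ler_nat; case: leP => // le.
  by rewrite mem_set.
rewrite ge0_integral_sum//; last 2 first.
- by move=> i; case: (fP i).
- by move=> i w _; rewrite lee_fin mulr_ge0.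
apply: (@le_trans _ _ (\sum_(i < n) (alpha / n%:R)%:E)%E).
  by apply: lee_sum => i _; case: (fP i).
by rewrite sumEFin lee_fin sumr_const card_ord -[X in X <= _]mulr_natr divfK// gt_eqF.
Qed.
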